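(* In every Dynamic Generative System with Symmetry (DGSS), for all objects $x, y, z$: $(x\,z) = (y\,z)$ if and only if $x = y$.
   Context: Relational Calculus: there is a collection of objects with a binary application operation; the application of $a$ to $b$ is written $(a\,b)$ and is again an object. Application is associative: for all objects $a,b,c$, $(a\,b\,c) = ((a\,b)\,c) = (a\,(b\,c))$. The symbol $=$ is the logical equality sign, with the classical deduction rules (reflexivity, symmetry, transitivity). A Dynamic Generative System with Symmetry (DGSS) is such a system with a distinguished object $\overline{x}$ satisfying: (i) for all $y$, $(\overline{x}\,y) = y$; (ii) for all $y$ there exists $z$ with $(z\,y) = \overline{x}$; (iii) for all $y$ there exists $z$ with $(z\,y) = (y\,z) = \overline{x}$. All variables range over all objects. *)

(* Defs.v *)
Record RelCalculus : Type := {
  obj :> Type;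
  app : obj -> obj -> obj;
  app_assoc : forall a b c : obj, app (app a b) c = app a (app b c)
}.

Arguments app {_} _ _.

(* The inverse on the left in [xbar_linv] and the two-sided one in [xbar_inv]
   are kept as separate axioms, as in the source, although the second implies
   the first. Only the left identity law is assumed. *)
Record DGSS : Type := {
  dgss_calculus :> RelCalculus;
  xbar : dgss_calculus;
  xbar_app : forall y : dgss_calculus, app xbar y = y;
  xbar_linv : forall y : dgss_calculus, exists z : dgss_calculus, app z y = xbar;
  xbar_inv : forall y : dgss_calculus,
    exists z : dgss_calculus, app z y = app y z /\ app y z = xbar
}.

(* Main.v *)
Require Import Defs.

(** A DGSS is a group, so an application on the right by [z] can be undone by
    applying to an inverse of [z]. Doing so turns [app x z = app y z] into
    [app x xbar = app y xbar], and it remains to know that [xbar] is neutral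
    on the right as well as on the left, which is [app_xbar]. *)

(** With [v] a two-sided inverse of [y], the product [y v y] is [app y xbar]
    when bracketed to the right and [app xbar y = y] when bracketed to the
    left. *)
Lemma app_xbar (D : DGSS) (y : D) : app y (xbar D) = y.
Proof.
  destruct (xbar_inv D y) as [v [Hcomm Hv]].
  rewrite <- Hv, <- Hcomm, <- app_assoc, Hv.
  apply xbar_app.
Qed.

Theorem proposition3p4 (D : DGSS) (x y z : D) : app x z = app y z <-> x = y.
Proof.
  split.
  - intros H.
    destruct (xbar_inv D z) as [w [_ Hw]].
    rewrite <- (app_xbar D x), <- (app_xbar D y), <- Hw, <- !app_assoc, H.
    reflexivity.
  - intros ->; reflexivity.
Qed.
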